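(* Consider an MPNN of depth $m$ on a graph $\mathsf{G}$ (as defined in the context), where $\sigma$ and all message functions $\psi^{(t)}$ are $\mathcal{C}^2$ functions. Let $c_\sigma,\omega,\mathsf{w},c_1,c_2,c^{(2)}$ be constants with $\mathsf{w}>0$ such that $|\sigma'|,|\sigma''|\le c_\sigma$ and, for all $1\le t\le m$, $\|\boldsymbol{\Omega}^{(t)}\|\le\omega$, $\|\mathbf{W}^{(t)}\|\le\mathsf{w}$, $\|\nabla_1\psi^{(t)}\|\le c_1$, $\|\nabla_2\psi^{(t)}\|\le c_2$, $\|\nabla^2\psi^{(t)}\|\le c^{(2)}$. Let $$\mathbf{S}:=\frac{\omega}{\mathsf{w}}\mathbf{I}+c_1\,\mathrm{diag}(\mathsf{A}\mathbf{1})+c_2\,\mathsf{A}\in\mathbb{R}^{n\times n},$$ and, for $0\le k\le m-1$, $$\mathbf{P}_k:=(\mathbf{S}^{m-k-1})^\top\mathrm{diag}(\mathbf{1}^\top\mathbf{S}^k)(\mathsf{A}\mathbf{S}^{m-k-1}),$$ $$\mathbf{Q}_k:=\mathbf{P}_k+\mathbf{P}_k^\top+(\mathbf{S}^{m-k-1})^\top\mathrm{diag}\big(\mathbf{1}^\top\mathbf{S}^k(\mathrm{diag}(\mathsf{A}\mathbf{1})+\mathsf{A})\big)\mathbf{S}^{m-k-1}.$$ If the readout is $\mathsf{MAX}$, $\mathsf{MEAN}$ or $\mathsf{SUM}$ and $\boldsymbol{\theta}$ has unit norm, then the mixing $\mathsf{mix}_{y^{(m)}_{\mathsf{G}}}(v,u)$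 induced by the MPNN over the features of nodes $v,u$ satisfies $$\mathsf{mix}_{y^{(m)}_{\mathsf{G}}}(v,u)\le\sum_{k=0}^{m-1}(c_\sigma\mathsf{w})^{2m-k-1}\Big(\mathsf{w}(\mathbf{S}^{m-k})^\top\mathrm{diag}(\mathbf{1}^\top\mathbf{S}^k)\mathbf{S}^{m-k}+c^{(2)}\mathbf{Q}_k\Big)_{vu}.$$
   Context: Graph: $\mathsf{G}=(\mathsf{V},\mathsf{E})$ is a fixed undirected, connected, non-bipartite graph with $n$ nodes. MPNN: each node $v$ carries a feature $\mathbf{x}_v\in\mathbb{R}^d$; $\mathbf{X}\in\mathbb{R}^{n\times d}$ is the feature matrix. $\mathsf{A}\in\mathbb{R}^{n\times n}$ is any matrix with $\mathsf{A}_{vu}>0$ if $(v,u)\in\mathsf{E}$ and $\mathsf{A}_{vu}=0$ otherwise. For $1\le t\le m$ the MPNN layer is $$\mathbf{h}_v^{(t)}=\sigma\Big(\boldsymbol{\Omega}^{(t)}\mathbf{h}_v^{(t-1)}+\mathbf{W}^{(t)}\sum_u\mathsf{A}_{vu}\,\psi^{(t)}(\mathbf{h}_v^{(t-1)},\mathbf{h}_u^{(t-1)})\Big),\qquad \mathbf{h}_v^{(0)}=\mathbf{x}_v,$$ with $\sigma:\mathbb{R}\to\mathbb{R}$ acting entrywise, $\boldsymbol{\Omega}^{(t)},\mathbf{W}^{(t)}\in\mathbb{R}^{d\times d}$ weight matrices, and message functions $\psi^{(t)}:\mathbb{R}^d\times\mathbb{R}^d\to\mathbb{R}^d$. The output is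 $y^{(m)}_{\mathsf{G}}(\mathbf{X})=\boldsymbol{\theta}^\top\mathsf{READ}(\{\mathbf{h}_v^{(m)}\}_{v\in\mathsf{V}})$ with $\boldsymbol{\theta}\in\mathbb{R}^d$, where $\mathsf{READ}$ is the permutation-invariant readout ($\mathsf{MAX}$, $\mathsf{MEAN}$, or $\mathsf{SUM}$, taken entrywise over the multiset of node features). Norms: $\|\cdot\|$ is the operator norm of a matrix, and bounds on derivatives hold at every argument. $\nabla_a\psi$ ($a=1,2$) is the $d\times d$ Jacobian of $\psi$ with respect to its $a$-th variable. $\nabla^2\psi$ is the Hessian of $\psi$, i.e. the block matrix with blocks $\nabla^2_{ab}\psi\in\mathbb{R}^{d\times d^2}$, $a,b\in\{1,2\}$ (block row $a$, block column $b$), where $(\nabla^2_{ab}\psi)_{r,d(\beta-1)+\gamma}=\partial_{a,\beta}\partial_{b,\gamma}\psi^r$, with $\partial_{a,\beta}$ the derivative in the $\beta$-th coordinate of the $a$-th variable and $\psi^r$ the $r$-th output component. $\mathbf{1}$ is the all-ones vector in $\mathbb{R}^n$; $\mathrm{diag}(\cdot)$ of a (row or column) vector is the corresponding diagonal matrix. Mixing: for a twice differentiable function $y$ of the node features $\mathbf{X}\in\mathbb{R}^{n\times d}$, the (maximal) mixing induced by $y$ among the features $\mathbf{x}_v$ and $\mathbf{x}_u$ is $$\mathsf{mix}_y(v,u)=\max_{\mathbf{X}}\max_{1\le\alpha,\beta\le d}\left|\frac{\partial^2y(\mathbf{X})}{\partial x_v^\alpha\partial x_u^\beta}\right|,$$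 where the first maximum is over all input features. *)

(* Defs.v *)
From mathcomp Require Import all_boot all_order all_algebra.
From mathcomp Require Import all_classical all_reals all_analysis.
Import Order.TTheory GRing.Theory Num.Theory.
Import numFieldNormedType.Exports.

Set Implicit Arguments.
Unset Strict Implicit.
Unset Printing Implicit Defensive.

Local Open Scope classical_set_scope.
Local Open Scope ring_scope.

(* A graph on n nodes is given by its adjacency relation; self-loops are
   neither required nor excluded. *)

Definition graph_connected (n : nat) (e : rel 'I_n) : Prop :=
  forall u v : 'I_n, connect e u v.

Definition graph_bipartite (n : nat) (e : rel 'I_n) : Prop :=
  exists col : 'I_n -> bool, forall u v : 'I_n, e u v -> col u != col v.

(* The library norm on matrices is the entrywise sup norm, hence the explicit
   Euclidean norm and the operator norm it induces. *)

Definition enorm (R : realType) (d : nat) (x : 'cV[R]_d) : R :=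
  Num.sqrt (\sum_(i < d) x i 0 ^+ 2).

Definition opnorm (R : realType) (p q : nat) (M : 'M[R]_(p, q)) : R :=
  sup [set enorm (M *m x) | x in [set x : 'cV[R]_q | enorm x <= 1]].

(* Between finite-dimensional spaces this is the usual class C^k: asking for
   continuous iterated derivatives along all vectors, or only along the
   coordinate directions, amounts to the same. *)
Fixpoint class_C (R : realType) (U V : normedModType R) (k : nat)
    (f : U -> V) : Prop :=
  match k with
  | 0 => continuous f
  | k'.+1 => continuous f /\
      forall w : U, (forall x, derivable f x w) /\ class_C k' ('D_w f)
  end.

(* Coordinate directions of the first and second variables of R^d x R^d. *)
Definition dir1 (R : realType) (d : nat) (b : 'I_d) : 'cV[R]_d * 'cV[R]_d :=
  (delta_mx b 0, 0).

Definition dir2 (R : realType) (d : nat) (b : 'I_d) : 'cV[R]_d * 'cV[R]_d :=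
  (0, delta_mx b 0).

Definition partial_jacobian (R : realType) (d : nat)
    (f : 'cV[R]_d * 'cV[R]_d -> 'cV[R]_d)
    (ea : 'I_d -> 'cV[R]_d * 'cV[R]_d) (p : 'cV[R]_d * 'cV[R]_d) : 'M[R]_d :=
  \matrix_(r, b) 'D_(ea b) (fun q => f q r 0) p.

(* mxvec flattens row by row: entry (b, c) goes to the 0-based column
   d * b + c. *)
Definition hessian_block (R : realType) (d : nat)
    (f : 'cV[R]_d * 'cV[R]_d -> 'cV[R]_d)
    (ea eb : 'I_d -> 'cV[R]_d * 'cV[R]_d) (p : 'cV[R]_d * 'cV[R]_d) :
    'M[R]_(d, d * d) :=
  \matrix_(r, j)
    mxvec (\matrix_(b < d, c < d)
      'D_(ea b) ('D_(eb c) (fun q => f q r 0)) p) 0 j.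

Definition hessian (R : realType) (d : nat)
    (f : 'cV[R]_d * 'cV[R]_d -> 'cV[R]_d) (p : 'cV[R]_d * 'cV[R]_d) :
    'M[R]_(d + d, d * d + d * d) :=
  block_mx (hessian_block f (@dir1 R d) (@dir1 R d) p)
           (hessian_block f (@dir1 R d) (@dir2 R d) p)
           (hessian_block f (@dir2 R d) (@dir1 R d) p)
           (hessian_block f (@dir2 R d) (@dir2 R d) p).

(* Layer t >= 1 uses Om t, W t and psi t; index 0 of these families is never
   used. *)
Fixpoint mpnn_layer (R : realType) (n d : nat) (A : 'M[R]_n) (sigma : R -> R)
    (Om W : nat -> 'M[R]_d) (psi : nat -> 'cV[R]_d * 'cV[R]_d -> 'cV[R]_d)
    (X : 'M[R]_(n, d)) (t : nat) (v : 'I_n) : 'cV[R]_d :=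
  match t with
  | 0 => (row v X)^T
  | t'.+1 =>
      let h := mpnn_layer A sigma Om W psi X t' in
      map_mx sigma
        (Om t'.+1 *m h v
         + W t'.+1 *m \sum_(u < n) A v u *: psi t'.+1 (h v, h u))
  end.

Variant readout := MAX | MEAN | SUM.

(* The sup below is over a finite set, nonempty for n > 0: it is a maximum. *)
Definition read (R : realType) (n d : nat) (rd : readout)
    (h : 'I_n -> 'cV[R]_d) : 'cV[R]_d :=
  \col_r match rd with
         | MAX => sup (range (fun v => h v r 0))
         | MEAN => n%:R^-1 * \sum_(v < n) h v r 0
         | SUM => \sum_(v < n) h v r 0
         end.

Definition mpnn_output (R : realType) (n d : nat) (A : 'M[R]_n)
    (sigma : R -> R) (Om W : nat -> 'M[R]_d)
    (psi : nat -> 'cV[R]_d * 'cV[R]_d -> 'cV[R]_d) (rd : readout)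
    (theta : 'cV[R]_d) (m : nat) (X : 'M[R]_(n, d)) : R :=
  (theta^T *m read rd (mpnn_layer A sigma Om W psi X m)) 0 0.

(* The second partial derivative of y at X along E, then F, exists: the first
   one (along F) exists at the points X + s E for small s, and is
   differentiable at X along E. *)
Definition derivable2 (R : realType) (n d : nat) (y : 'M[R]_(n, d) -> R)
    (X E F : 'M[R]_(n, d)) : Prop :=
  (\forall s \near (0 : R), derivable y (X + s *: E) F)
  /\ derivable ('D_F y) X E.

(* The supremum is taken in the extended reals, so that it is never a junk
   value.  The restriction to the X where the second partial derivative exists
   is void for a twice differentiable y; it matters for the MAX readout, whose
   output is not differentiable everywhere. *)
Definition mix (R : realType) (n d : nat) (y : 'M[R]_(n, d) -> R)
    (v u : 'I_n) : \bar R :=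
  ereal_sup [set r : \bar R | exists (X : 'M[R]_(n, d)) (a b : 'I_d),
    derivable2 y X (delta_mx v a) (delta_mx u b) /\
    r = (`| 'D_(delta_mx v a) ('D_(delta_mx u b) y) X |)%:E].

Definition ones (R : realType) (n : nat) : 'cV[R]_n := const_mx 1.

Definition diag_deg (R : realType) (n : nat) (A : 'M[R]_n) : 'M[R]_n :=
  diag_mx (A *m ones R n)^T.

Definition S_mx (R : realType) (n : nat) (A : 'M[R]_n) (om w c1 c2 : R) :
    'M[R]_n :=
  (om / w)%:M + c1 *: diag_deg A + c2 *: A.

Definition P_mx (R : realType) (n : nat) (A S : 'M[R]_n) (m k : nat) :
    'M[R]_n :=
  (S ^+ (m - k - 1))^T *m diag_mx ((ones R n)^T *m S ^+ k)
    *m (A *m S ^+ (m - k - 1)).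

Definition Q_mx (R : realType) (n : nat) (A S : 'M[R]_n) (m k : nat) :
    'M[R]_n :=
  P_mx A S m k + (P_mx A S m k)^T
  + (S ^+ (m - k - 1))^T
      *m diag_mx ((ones R n)^T *m S ^+ k *m (diag_deg A + A))
      *m S ^+ (m - k - 1).

(* Main.v *)
(* Let rho = c_sigma w.  Along coordinate directions E of x_v and F of x_u, the
   chain rule bounds |D_E h^t_i| by rho^t (S^t)_iv, and |D_E D_F h^t_i| by a
   quantity M^t_i with M^(t+1) = rho S M^t + rho^(2t+1) T_(t+1), where T_(t+1)
   gathers the sigma'' term and the Hessian terms of the layer.  Unrolling the
   recurrence and summing over i yields the right-hand side.

   The output with MAX is not differentiable everywhere, but at every point it
   coincides with one of finitely many C^2 functions, each a combination of the
   features of selected nodes.  If f is derivable at 0 and every f s is one of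
   finitely many g_i s with g_i derivable at 0, then some i has
   f'(0) = g_i'(0): otherwise f would differ from all g_i at small s <> 0.
   Applied twice, this shows that a mixed derivative of the output, where it
   exists, equals the one of some selection. *)

Require Import Defs.
From HB Require Import structures.
From mathcomp Require Import all_boot all_order all_algebra.
From mathcomp Require Import all_classical all_reals all_analysis.
From mathcomp Require Import ring lra zify.
Import Order.TTheory GRing.Theory Num.Theory.
Import numFieldNormedType.Exports.

Local Open Scope classical_set_scope.
Local Open Scope ring_scope.

Set Implicit Arguments.
Unset Strict Implicit.

(** * Differentiability from continuous partial derivatives *)

(** The two difference quotients are the same function of the increment; this turns a directional
    derivative into a derivative on the real line, where the mean value theorem applies. *)
Lemma is_derive_line (R : realType) (U : normedModType R) (f : U -> R)
    (y w : U) (t : R) :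
  derivable f (y + t *: w) w ->
  is_derive t (1 : R) (fun s : R => f (y + s *: w)) ('D_w f (y + t *: w)).
Proof.
move=> df.
have E : (fun h : R => h^-1 *: (((fun s : R => f (y + s *: w)) \o shift t) (h *: (1 : R))
    - f (y + t *: w))) =
  (fun h : R => h^-1 *: ((f \o shift (y + t *: w)) (h *: w) - f (y + t *: w))).
  apply/funext => h /=; rewrite /shift/=; congr (_ *: (f _ - _)).
  by rewrite scalerDl [h *: 1]mulr1 addrCA.
by split; rewrite /derivable /derive E.
Qed.

Lemma mean_value_line (R : realType) (U : normedModType R) (f : U -> R)
    (y w : U) (c : R) :
  (forall x, derivable f x w) ->
  exists2 t, `|t| <= `|c| & f (y + c *: w) - f y = c * 'D_w f (y + t *: w).
Proof.
move=> df; set g := fun s : R => f (y + s *: w).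
have dg t : is_derive t (1 : R) g ('D_w f (y + t *: w)) by exact: is_derive_line.
have cg (A : set R) : {within A, continuous g}.
  apply: continuous_subspaceT => t; apply: differentiable_continuous.
  by apply/derivable1_diffP; apply: ex_derive.
have -> : f y = g 0 by rewrite /g scale0r addr0.
have -> : f (y + c *: w) = g c by [].
(* The increment [c] may have either sign, while [MVT_segment] expects ordered endpoints. *)
have [c0|/ltW c0] := leP 0 c.
- have [t] := MVT_segment c0 (fun x _ => dg x) (cg _).
  rewrite in_itv/= => /andP[t0 tc] ->; exists t.
    by rewrite !ger0_norm.
  by rewrite subr0 mulrC.
- have [t] := MVT_segment c0 (fun x _ => dg x) (cg _).
  rewrite in_itv/= => /andP[t0 tc] E; exists t.
    by rewrite !ler0_norm // lerN2.
  by rewrite -opprB E sub0r mulrN opprK mulrC.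
Qed.

Section C1_differentiable.
Context {R : realType} {U : normedModType R} {I : finType}.
Variables (w : I -> U) (c : I -> {linear U -> R}).
Hypothesis c_cont : forall i, continuous (c i).
Hypothesis c_span : forall h, h = \sum_i c i h *: w i.

Let coord_bound (r : seq I) :
  exists2 k, 0 < k & forall h, \sum_(i <- r) `|c i h| <= k * `|h|.
Proof.
elim: r => [|i r [k k0 kr]]; first by exists 1 => // h; rewrite big_nil mul1r.
have [k' k'0 k'i] := linear_lipschitz (@c_cont i).
exists (k' + k) => [|h]; first exact: addr_gt0.
by rewrite big_cons mulrDl lerD.
Qed.

(* Changing one coordinate at a time, the mean value theorem gives each
   increment of f. *)
Let telescope (f : U -> R) (x : U) (r : seq I) :
  (forall i y, derivable f y (w i)) ->
  (forall i, {for x, continuous ('D_(w i) f)}) ->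
  forall eps, 0 < eps -> \forall h \near (0 : U),
    `|f (x + \sum_(i <- r) c i h *: w i) - f x
      - \sum_(i <- r) c i h * 'D_(w i) f x| <= eps * `|h|.
Proof.
move=> df dfc; elim: r => [|i r IH] eps e0.
  near=> h; rewrite !big_nil addr0 !subrr normr0.
  by rewrite mulr_ge0 // ltW.
have e20 : 0 < eps / 2 by rewrite divr_gt0.
have [k k0 ki] := linear_lipschitz (@c_cont i).
have [k' k'0 kr] := coord_bound r.
(* Half of [eps] pays for the coordinates of [r], half for [i]. Since [|c i h| <= k * |h|], the
   partial derivative along [w i] may vary by at most [eps / 2 / k]. *)
have ek : 0 < eps / 2 / k by rewrite divr_gt0.
have /cvgrPdist_le /(_ _ ek) := dfc i.
move=> /nbhs_ballP[del /= del0 Hdel].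
(* The point given by the mean value theorem lies within [M * |h|] of [x], hence in the ball of
   radius [del] for small [h]; the [+ 1] makes [M] positive. *)
pose M := k' * (\sum_(j <- i :: r) `|w j|) + k * `|w i| + 1.
have M0 : 0 < M.
  by rewrite /M ltr_wpDl // addr_ge0 // mulr_ge0 ?sumr_ge0 // ltW.
near=> h.
rewrite !big_cons.
set s := \sum_(j <- r) c j h *: w j.
have sE : `|s| <= k' * `|h| * (\sum_(j <- i :: r) `|w j|).
  rewrite mulr_sumr big_cons.
  apply: (@le_trans _ _ (\sum_(j <- r) k' * `|h| * `|w j|)); last first.
    by rewrite lerDr mulr_ge0 // mulr_ge0 // ltW.
  apply: le_trans (ler_norm_sum _ _ _) _.
  rewrite big_seq [leRHS]big_seq ler_sum // => j jr; rewrite normrZ ler_wpM2r //.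
  apply: le_trans (kr h).
  by rewrite (big_rem _ jr) /= lerDl sumr_ge0.
have [t tc E] := mean_value_line (x + s) (c i h) (df i).
have -> : x + (c i h *: w i + s) = x + s + c i h *: w i.
  by rewrite [_ + s]addrC addrA.
have -> : f (x + s + c i h *: w i) - f x - (c i h * 'D_(w i) f x + \sum_(j <- r) c j h * 'D_(w j) f x)
  = (f (x + s) - f x - \sum_(j <- r) c j h * 'D_(w j) f x)
    + c i h * ('D_(w i) f (x + s + t *: w i) - 'D_(w i) f x).
  by rewrite mulrBr -E; ring.
apply: (le_trans (ler_normD _ _)).
rewrite (splitr eps) mulrDl lerD //.
  by rewrite /s; near: h; exact: IH.
rewrite normrM.
have -> : eps / 2 * `|h| = (k * `|h|) * (eps / 2 / k).
  by field; rewrite gt_eqF.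
apply: ler_pM => //.
rewrite distrC; apply: Hdel.
rewrite -ball_normE /= !opprD !addrA subrr sub0r.
have -> : - s - t *: w i = - (s + t *: w i) by rewrite opprD.
rewrite normrN; apply: le_lt_trans (ler_normD _ _) _.
have H1 : `|t *: w i| <= k * `|h| * `|w i|.
  by rewrite normrZ ler_wpM2r // (le_trans tc).
apply: le_lt_trans (lerD sE H1) _.
apply: (@le_lt_trans _ _ (M * `|h|)).
  rewrite /M !mulrDl mul1r -!mulrA ![`|h| * _]mulrC.
  by rewrite !mulrA lerDl.
rewrite -ltr_pdivlMl //.
by near: h; apply: nbhs0_lt; rewrite mulr_gt0 ?invr_gt0.
Unshelve. all: by end_near. Qed.

(** The candidate differential [L] combines the partial derivatives at [x] with the coordinates of
    the increment. It is continuous because the coordinates are Lipschitz, and [telescope] over all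
    indices says that the remainder is o(h). *)
Lemma differentiable_C1 (f : U -> R) (x : U) :
  (forall i y, derivable f y (w i)) ->
  (forall i, {for x, continuous ('D_(w i) f)}) ->
  differentiable f x.
Proof.
move=> df dfc.
pose L h := \sum_i c i h * 'D_(w i) f x.
have Llin : linear L.
  move=> a u v; rewrite /L scaler_sumr -big_split /=; apply: eq_bigr => i _.
  by rewrite linearP mulrDl scalerAl.
pose LM := GRing.isLinear.Build _ _ _ _ _ Llin.
pose LL : {linear U -> R} := HB.pack L LM.
have LLc : continuous LL.
  apply: bounded_linear_continuous; apply/linear_boundedP.
  have [k k0 kr] := coord_bound (index_enum I).
  exists (k * \sum_i `|'D_(w i) f x|); split; first exact: num_real.
  move=> r /ltW kDr h; rewrite /LL /= /L.
  apply: le_trans (ler_norm_sum _ _ _) _.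
  apply: (@le_trans _ _ (k * `|h| * \sum_i `|'D_(w i) f x|)).
    rewrite mulr_sumr ler_sum // => i _; rewrite normrM ler_wpM2r //.
    by apply: le_trans (kr h); rewrite (bigD1 i) //= lerDl sumr_ge0.
  by rewrite mulrAC ler_wpM2r.
have LLo : f \o shift x = cst (f x) + (LL : U -> R) +o_ 0 id.
  apply/eqaddoP => eps e0.
  near=> h.
  have -> : (f \o shift x - (cst (f x) + (LL : U -> R))) h =
      f (x + \sum_i c i h *: w i) - f x - L h.
    by rewrite -c_span opprD addrA [x + h]addrC.
  by near: h; exact: telescope.
by apply/diff_locallyP; rewrite (diff_unique LLc LLo); split.
Unshelve. all: by end_near. Qed.
End C1_differentiable.

(** * Second derivatives of compositions *)

Lemma differentiable_bigsum (R : realType) (U W : normedModType R) (I : Type)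
    (r : seq I) (f : I -> U -> W) (x : U) :
  (forall i, differentiable (f i) x) ->
  differentiable (fun y => \sum_(i <- r) f i y) x.
Proof.
move=> df; elim: r => [|i r IH].
  rewrite (_ : (fun y => _) = cst 0); first exact: differentiable_cst.
  by apply/funext => y; rewrite big_nil.
rewrite (_ : (fun y => _) = f i + (fun y => \sum_(i <- r) f i y)).
  exact: differentiableD.
by apply/funext => y; rewrite big_cons.
Qed.

Lemma derive_bigsum (R : realType) (U W : normedModType R) (I : Type)
    (r : seq I) (f : I -> U -> W) (x v : U) :
  (forall i, differentiable (f i) x) ->
  'D_v (fun y => \sum_(i <- r) f i y) x = \sum_(i <- r) 'D_v (f i) x.
Proof.
move=> df; elim: r => [|i r IH].
  rewrite (_ : (fun y => _) = cst 0); first by rewrite derive_cst big_nil.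
  by apply/funext => y; rewrite big_nil.
rewrite (_ : (fun y => _) = f i + (fun y => \sum_(i <- r) f i y)).
  rewrite deriveD ?big_cons ?IH //; apply: diff_derivable => //.
  exact: differentiable_bigsum.
by apply/funext => y; rewrite big_cons.
Qed.

Section chain_rule.
Context {R : realType} {U V : normedModType R} {I : finType}.
Variables (w : I -> V) (g : I -> U -> R).

(** A map given by scalar components along fixed directions: derivatives of [f \o span_map] then
    involve [f] only through its derivatives along the [w i], which are the entries of Jacobians and
    Hessians. *)
Definition span_map (x : U) : V := \sum_i g i x *: w i.

Hypothesis g_diff : forall i x, differentiable (g i) x.

Lemma differentiable_span_map x : differentiable span_map x.
Proof.
by apply: differentiable_bigsum => i; apply: differentiableZl; exact: g_diff.
Qed.

Lemma derive_span_map x v : 'D_v span_map x = \sum_i 'D_v (g i) x *: w i.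
Proof.
rewrite derive_bigsum => [|i]; last exact: differentiableZl.
by apply: eq_bigr => i _; rewrite !deriveE ?diffZl //; exact: differentiableZl.
Qed.

Lemma derive_comp_span (f : V -> R) x v :
  differentiable f (span_map x) ->
  'D_v (f \o span_map) x = \sum_i 'D_(w i) f (span_map x) * 'D_v (g i) x.
Proof.
move=> df; have dg := differentiable_span_map x.
rewrite deriveE; last exact: differentiable_comp.
rewrite diff_comp //= -[X in 'd f _ X]deriveE // derive_span_map linear_sum.
by apply: eq_bigr => i _; rewrite linearZ /= -deriveE // mulrC.
Qed.
End chain_rule.

(** A form of twice differentiability stable under linear combinations and compositions. The first
    derivatives are differentiable in the Fréchet sense, so the chain rule applies to them in
    turn. *)
Definition diff2 (R : realType) (U : normedModType R) (f : U -> R) : Prop :=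
  (forall x, differentiable f x) /\ forall w x, differentiable ('D_w f) x.

Section diff2.
Context {R : realType} {U : normedModType R}.
Implicit Types (f g : U -> R) (E F x : U).

Lemma diff2D f g : diff2 f -> diff2 g -> diff2 (fun y => f y + g y).
Proof.
move=> [f1 f2] [g1 g2]; split => [x|w x]; first exact: differentiableD.
rewrite (_ : 'D_w _ = 'D_w f + 'D_w g); first exact: differentiableD.
by apply/funext => y; rewrite deriveD //; exact: diff_derivable.
Qed.

Lemma derive2D f g E F x : diff2 f -> diff2 g ->
  'D_E ('D_F (fun y => f y + g y)) x = 'D_E ('D_F f) x + 'D_E ('D_F g) x.
Proof.
move=> [f1 f2] [g1 g2].
rewrite (_ : 'D_F _ = 'D_F f + 'D_F g).
  by rewrite deriveD //; exact: diff_derivable.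
by apply/funext => y; rewrite deriveD //; exact: diff_derivable.
Qed.

Lemma derive_lincomb (I : finType) (a : I -> R) (f : I -> U -> R) F x :
  (forall i, differentiable (f i) x) ->
  'D_F (fun y => \sum_i a i * f i y) x = \sum_i a i * 'D_F (f i) x.
Proof.
move=> df; rewrite derive_bigsum => [|i]; last exact: differentiableZ.
by apply: eq_bigr => i _; rewrite deriveZ //; exact: diff_derivable.
Qed.

Section lincomb.
Context {I : finType}.
Variables (a : I -> R) (f : I -> U -> R).

Hypothesis f_diff2 : forall i, diff2 (f i).

Let derive_lincombE F : 'D_F (fun y => \sum_i a i * f i y) =
  (fun y => \sum_i a i * 'D_F (f i) y).
Proof.
by apply/funext => y; apply: derive_lincomb => i; case: (f_diff2 i).
Qed.

Lemma diff2_lincomb : diff2 (fun y => \sum_i a i * f i y).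
Proof.
split => [x|w x].
  apply: differentiable_bigsum => i; apply: differentiableZ.
  by case: (f_diff2 i).
rewrite derive_lincombE; apply: differentiable_bigsum => i.
by apply: differentiableZ; case: (f_diff2 i).
Qed.

Lemma derive2_lincomb E F x :
  'D_E ('D_F (fun y => \sum_i a i * f i y)) x =
  \sum_i a i * 'D_E ('D_F (f i)) x.
Proof.
by rewrite derive_lincombE derive_lincomb // => i; case: (f_diff2 i).
Qed.
End lincomb.

Section comp.
Context {V : normedModType R} {I : finType}.
Variables (w : I -> V) (g : I -> U -> R) (f : V -> R).
Hypothesis g_diff2 : forall i, diff2 (g i).
Hypothesis f_diff2 : diff2 f.

Let G := span_map w g.

Let g_diff i x : differentiable (g i) x.
Proof. by case: (g_diff2 i). Qed.

Let derive_compE F :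
  'D_F (f \o G) = (fun y => \sum_i 'D_(w i) f (G y) * 'D_F (g i) y).
Proof.
by apply/funext => y; apply: derive_comp_span => //; case: f_diff2.
Qed.

Let derive_comp_diff F i y :
  differentiable (('D_(w i) f \o G) * 'D_F (g i)) y.
Proof.
apply: differentiableM; last by case: (g_diff2 i).
apply: differentiable_comp; first exact: differentiable_span_map.
by case: f_diff2.
Qed.

Lemma diff2_comp : diff2 (f \o span_map w g).
Proof.
split => [x|v x].
  apply: differentiable_comp; first exact: differentiable_span_map.
  by case: f_diff2.
rewrite derive_compE; apply: differentiable_bigsum => i.
exact: derive_comp_diff.
Qed.

(** The product rule is applied to each term of the first-order chain rule: one part differentiates
    ['D_(w i) f] along the inner map and gives the Hessian term, the other gives the gradient
    term. *)
Lemma derive2_comp E F x :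
  'D_E ('D_F (f \o span_map w g)) x =
  \sum_i (\sum_j 'D_(w j) ('D_(w i) f) (span_map w g x) * 'D_E (g j) x)
            * 'D_F (g i) x
  + \sum_i 'D_(w i) f (span_map w g x) * 'D_E ('D_F (g i)) x.
Proof.
rewrite derive_compE derive_bigsum => [|i]; last exact: derive_comp_diff.
rewrite -big_split /=; apply: eq_bigr => i _.
have [f1 f2] := f_diff2.
rewrite (deriveM (f := 'D_(w i) f \o G)); last 2 first.
- apply: diff_derivable; apply: differentiable_comp => //.
  exact: differentiable_span_map.
- by apply: diff_derivable; case: (g_diff2 i).
rewrite (derive_comp_span g_diff) // addrC; congr (_ + _).
by rewrite [LHS]mulrC.
Qed.
End comp.
End diff2.

(** * Euclidean and operator norms *)

Section euclidean_norm.
Context {R : realType}.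

Lemma enorm_ge0 d (x : 'cV[R]_d) : 0 <= enorm x.
Proof. exact: sqrtr_ge0. Qed.

Lemma enorm_sqr d (x : 'cV[R]_d) : enorm x ^+ 2 = \sum_i x i 0 ^+ 2.
Proof. by rewrite sqr_sqrtr // sumr_ge0 // => i _; rewrite sqr_ge0. Qed.

Lemma enorm_eq0 d (x : 'cV[R]_d) : enorm x = 0 -> x = 0.
Proof.
move=> x0; have /eqP := enorm_sqr x; rewrite x0 expr0n /= eq_sym.
rewrite psumr_eq0 => [/allP xi|i _]; last exact: sqr_ge0.
apply/colP => i; rewrite mxE; apply/eqP; rewrite -sqrf_eq0.
exact: (implyP (xi i (mem_index_enum _))).
Qed.

Lemma enormZ d (a : R) (x : 'cV[R]_d) : enorm (a *: x) = `|a| * enorm x.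
Proof.
rewrite /enorm -sqrtr_sqr -sqrtrM ?sqr_ge0 //; congr Num.sqrt.
by rewrite mulr_sumr; apply: eq_bigr => i _; rewrite mxE exprMn.
Qed.

Lemma enorm0 d : enorm (0 : 'cV[R]_d) = 0.
Proof. by rewrite -(scale0r 0) enormZ normr0 mul0r. Qed.

Lemma enorm_le d (a : R) (x y : 'cV[R]_d) : 0 <= a ->
  (forall i, `|x i 0| <= a * `|y i 0|) -> enorm x <= a * enorm y.
Proof.
move=> a0 xy; rewrite -[a]ger0_norm // -enormZ ler_wsqrtr // ler_sum // => i _.
rewrite mxE -[leLHS]real_normK ?num_real // -[leRHS]real_normK ?num_real //.
by rewrite ler_sqr ?nnegrE // normrM (ger0_norm a0).
Qed.

Lemma coord_le_enorm d (x : 'cV[R]_d) i : `|x i 0| <= enorm x.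
Proof.
rewrite -sqrtr_sqr ler_wsqrtr // (bigD1 i) //= lerDl sumr_ge0 // => j _.
exact: sqr_ge0.
Qed.

(** Cauchy-Schwarz, obtained for nonzero vectors by expanding the nonnegative sum of the squares of
    [enorm y * x i 0 - enorm x * y i 0]. *)
Lemma enorm_dot d (x y : 'cV[R]_d) :
  \sum_i x i 0 * y i 0 <= enorm x * enorm y.
Proof.
have [/enorm_eq0 ->|x0] := eqVneq (enorm x) 0.
  by rewrite enorm0 mul0r big1 // => i _; rewrite mxE mul0r.
have [/enorm_eq0 ->|y0] := eqVneq (enorm y) 0.
  by rewrite enorm0 mulr0 big1 // => i _; rewrite mxE mulr0.
have xy0 : 0 < enorm x * enorm y by rewrite mulr_gt0 // lt0r ?x0 ?y0 enorm_ge0.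
rewrite -(ler_pM2l xy0).
have : 0 <= \sum_i (enorm y * x i 0 - enorm x * y i 0) ^+ 2.
  by rewrite sumr_ge0 // => i _; rewrite sqr_ge0.
rewrite (eq_bigr (fun i => (enorm y ^+ 2 * x i 0 ^+ 2 + enorm x ^+ 2 * y i 0 ^+ 2)
   + (- 2 * (enorm x * enorm y)) * (x i 0 * y i 0))); last by move=> i _; ring.
rewrite !big_split /= -!mulr_sumr -!enorm_sqr.
set s := \sum_i _; move: (enorm x) (enorm y) s => a b s; nra.
Qed.

Lemma enormD d (x y : 'cV[R]_d) : enorm (x + y) <= enorm x + enorm y.
Proof.
rewrite -ler_sqr ?nnegrE ?enorm_ge0 ?addr_ge0 ?enorm_ge0 // enorm_sqr.
rewrite (eq_bigr (fun i => (x i 0 ^+ 2 + y i 0 ^+ 2) + 2 * (x i 0 * y i 0))).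
  rewrite !big_split /= -mulr_sumr -!enorm_sqr; have := enorm_dot x y.
  by move: (enorm x) (enorm y) (\sum_i _) => a b s; nra.
by move=> i _; rewrite mxE; ring.
Qed.

Lemma enorm_sum d (I : finType) (x : I -> 'cV[R]_d) :
  enorm (\sum_i x i) <= \sum_i enorm (x i).
Proof.
elim/big_ind2: _ => [|a b c e ab ce|//]; first by rewrite enorm0.
by apply: le_trans (enormD _ _) _; rewrite lerD.
Qed.

Lemma enorm_delta d (i : 'I_d) : enorm (delta_mx i 0 : 'cV[R]_d) = 1.
Proof.
rewrite /enorm (bigD1 i) //= mxE !eqxx expr1n big1 ?addr0 ?sqrtr1 // => j ji.
by rewrite mxE (negbTE ji) expr0n.
Qed.

Lemma enorm_le_norm1 d (x : 'cV[R]_d) : enorm x <= \sum_i `|x i 0|.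
Proof.
have {1}-> : x = \sum_i x i 0 *: delta_mx i 0.
  by rewrite [LHS]matrix_sum_delta; apply: eq_bigr => i _; rewrite big_ord1.
apply: le_trans (enorm_sum _) _; rewrite ler_sum // => i _.
by rewrite enormZ enorm_delta mulr1.
Qed.

Lemma enorm_col_mx p q (x : 'cV[R]_p) (y : 'cV[R]_q) :
  enorm (col_mx x y) ^+ 2 = enorm x ^+ 2 + enorm y ^+ 2.
Proof.
rewrite !enorm_sqr big_split_ord /=; congr (_ + _); apply: eq_bigr => i _.
  by rewrite col_mxEu.
by rewrite col_mxEd.
Qed.

Lemma enorm_hadamard d (x y : 'cV[R]_d) :
  enorm (\col_i (x i 0 * y i 0)) <= enorm x * enorm y.
Proof.
rewrite mulrC; apply: enorm_le => [|i]; first exact: enorm_ge0.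
by rewrite mxE normrM mulrC ler_wpM2r // coord_le_enorm.
Qed.

Lemma enorm_mxvec p q (M : 'M[R]_(p, q)) :
  enorm (mxvec M)^T ^+ 2 = \sum_i \sum_j M i j ^+ 2.
Proof.
rewrite enorm_sqr (reindex _ (curry_mxvec_bij p q)) /=.
rewrite pair_bigA /=; apply: eq_bigr => -[i j] _ /=.
by rewrite mxE mxvecE.
Qed.

(** A Hessian block evaluates its bilinear form at [x], [y] by acting on this flattened outer
    product, whose Euclidean norm is the Frobenius norm of a rank one matrix and therefore
    factorizes. *)
Lemma enorm_outer p q (x : 'cV[R]_p) (y : 'cV[R]_q) :
  enorm (mxvec (x *m y^T))^T = enorm x * enorm y.
Proof.
apply/eqP; rewrite -(@eqrXn2 _ 2) ?mulr_ge0 ?enorm_ge0 //.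
rewrite enorm_mxvec exprMn !enorm_sqr mulr_suml; apply/eqP/eq_bigr => i _.
rewrite mulr_sumr; apply: eq_bigr => j _.
by rewrite mxE big_ord1 mxE exprMn.
Qed.

Let opnorm_set p q (M : 'M[R]_(p, q)) :=
  [set enorm (M *m x) | x in [set x : 'cV[R]_q | enorm x <= 1]].

(** [sup] takes a default value on empty or unbounded sets, so [opnorm] is meaningful only once this
    is known. Cauchy-Schwarz on each row shows that the sum of the row norms is an upper bound. *)
Let opnorm_has_sup p q (M : 'M[R]_(p, q)) : has_sup (opnorm_set M).
Proof.
split; first by exists (enorm (M *m 0)), 0 => //=; rewrite enorm0.
exists (\sum_i enorm (row i M)^T) => _ [x /= x1 <-].
apply: le_trans (enorm_le_norm1 _) _; rewrite ler_sum // => i _.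
have Mx (z : 'cV[R]_q) : (M *m z) i 0 <= enorm (row i M)^T * enorm z.
  apply: le_trans (enorm_dot _ _); rewrite mxE le_eqVlt; apply/orP; left.
  by apply/eqP/eq_bigr => j _; rewrite !mxE.
apply: (@le_trans _ _ (enorm (row i M)^T * enorm x)); last first.
  by rewrite ler_piMr // enorm_ge0.
(* The lower bound on the coordinate is the upper bound at [- x]. *)
rewrite ler_norml Mx andbT lerNl; have := Mx (- x).
by rewrite mulmxN mxE -[in enorm (- x)]scaleN1r enormZ normrN1 mul1r.
Qed.

Lemma opnorm_ge0 p q (M : 'M[R]_(p, q)) : 0 <= opnorm M.
Proof.
apply: (@le_trans _ _ (enorm (M *m 0))); first exact: enorm_ge0.
rewrite /opnorm; apply: (sup_upper_bound (opnorm_has_sup M)).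
by exists 0 => //=; rewrite enorm0.
Qed.

Lemma enorm_mulmx p q (M : 'M[R]_(p, q)) (x : 'cV[R]_q) :
  enorm (M *m x) <= opnorm M * enorm x.
Proof.
have [/enorm_eq0 ->|x0] := eqVneq (enorm x) 0.
  by rewrite mulmx0 !enorm0 mulr0.
have {}x0 : 0 < enorm x by rewrite lt0r x0 enorm_ge0.
have nx : `|(enorm x)^-1| = (enorm x)^-1 by rewrite ger0_norm // invr_ge0 ltW.
rewrite -ler_pdivrMr // mulrC -nx -enormZ scalemxAr.
rewrite /opnorm; apply: (sup_upper_bound (opnorm_has_sup M)).
by exists ((enorm x)^-1 *: x); rewrite //= enormZ nx mulVf // gt_eqF.
Qed.

Lemma enorm_mulmx_le p q (M : 'M[R]_(p, q)) (x : 'cV[R]_q) (c b : R) :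
  opnorm M <= c -> enorm x <= b -> enorm (M *m x) <= c * b.
Proof.
move=> Mc xb; apply: le_trans (enorm_mulmx _ _) _.
by rewrite ler_pM // ?opnorm_ge0 ?enorm_ge0.
Qed.

Section blocks.
Context {p1 p2 q1 q2 : nat}.
Variables (M : 'M[R]_(p1, q1)) (N : 'M[R]_(p1, q2)).
Variables (P : 'M[R]_(p2, q1)) (Q : 'M[R]_(p2, q2)).

Let enorm_col0 q (x : 'cV[R]_q) p : enorm (col_mx x (0 : 'cV[R]_p)) = enorm x.
Proof.
apply/eqP; rewrite -(@eqrXn2 _ 2) ?enorm_ge0 //.
by rewrite enorm_col_mx enorm0 expr0n addr0.
Qed.

Let enorm_0col q (x : 'cV[R]_q) p : enorm (col_mx (0 : 'cV[R]_p) x) = enorm x.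
Proof.
apply/eqP; rewrite -(@eqrXn2 _ 2) ?enorm_ge0 //.
by rewrite enorm_col_mx enorm0 expr0n add0r.
Qed.

Let enorm_usub p q (x : 'cV[R]_p) (y : 'cV[R]_q) : enorm x <= enorm (col_mx x y).
Proof.
rewrite -ler_sqr ?nnegrE ?enorm_ge0 // enorm_col_mx lerDl; exact: sqr_ge0.
Qed.

Let enorm_dsub p q (x : 'cV[R]_p) (y : 'cV[R]_q) : enorm y <= enorm (col_mx x y).
Proof.
rewrite -ler_sqr ?nnegrE ?enorm_ge0 // enorm_col_mx lerDr; exact: sqr_ge0.
Qed.

(** The block matrix is applied to a vector padded with zeros; either half of the image is no longer
    than the whole. *)
Lemma enorm_block_mx (x : 'cV[R]_q1) (y : 'cV[R]_q2) :
  [/\ enorm (M *m x) <= opnorm (block_mx M N P Q) * enorm x,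
      enorm (N *m y) <= opnorm (block_mx M N P Q) * enorm y,
      enorm (P *m x) <= opnorm (block_mx M N P Q) * enorm x &
      enorm (Q *m y) <= opnorm (block_mx M N P Q) * enorm y].
Proof.
have X := enorm_mulmx (block_mx M N P Q) (col_mx x 0).
have Y := enorm_mulmx (block_mx M N P Q) (col_mx 0 y).
rewrite mul_block_col !mulmx0 !addr0 enorm_col0 in X.
rewrite mul_block_col !mulmx0 !add0r enorm_0col in Y.
split; [apply: le_trans X|apply: le_trans Y|apply: le_trans X|apply: le_trans Y] => //.
Qed.
End blocks.
End euclidean_norm.

(** * Second derivatives of activations and messages *)

Lemma class_C2_diff2_real (R : realType) (f : R -> R) :
  class_C 2 f -> diff2 f.
Proof.
move=> [_ fC]; split=> [x|w x].
  by apply/derivable1_diffP; case: (fC 1) => + _; apply.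
case: (fC w) => _ [_ /(_ 1)[+ _]] => dfw.
exact/derivable1_diffP.
Qed.

Section coordinates.
Context {R : realType} {d : nat}.
Let V : normedModType R := ('cV[R]_d * 'cV[R]_d)%type.

(** Indexing the 2d coordinate directions by a sum type lets sums over them split into the two
    variables of a message function. *)
Definition pair_dir (i : 'I_d + 'I_d) : V :=
  match i with inl b => @dir1 R d b | inr b => @dir2 R d b end.

Definition pair_coord (i : 'I_d + 'I_d) (p : V) : R :=
  match i with inl b => p.1 b 0 | inr b => p.2 b 0 end.

Let pair_coord_linear i : linear (pair_coord i).
Proof. by case: i => b a p q /=; rewrite !mxE. Qed.

HB.instance Definition _ i :=
  GRing.isLinear.Build R V R _ (pair_coord i) (pair_coord_linear i).

Lemma pair_coord_continuous i : continuous (pair_coord i).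
Proof.
case: i => b p /=; apply: (@continuous_comp _ _ _ _ (fun z : 'cV[R]_d => z b 0)).
- exact: cvg_fst.
- exact: coord_continuous.
- exact: cvg_snd.
- exact: coord_continuous.
Qed.

Lemma sum_pair_dir (a : 'I_d + 'I_d -> R) :
  \sum_i a i *: pair_dir i = (\col_b a (inl b), \col_b a (inr b)).
Proof.
have fstE : {morph (@fst 'cV[R]_d 'cV[R]_d) : p q / p + q} by [].
have sndE : {morph (@snd 'cV[R]_d 'cV[R]_d) : p q / p + q} by [].
rewrite big_sumType [LHS]surjective_pairing /=; congr (_, _).
  rewrite (big_morph _ fstE erefl) [X in _ + X](big_morph _ fstE erefl) /=.
  rewrite [X in _ + X]big1 ?addr0 => [|b _]; last exact: scaler0.
  rewrite [RHS]matrix_sum_delta; apply: eq_bigr => b _.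
  by rewrite big_ord1 mxE.
rewrite (big_morph _ sndE erefl) [X in _ + X](big_morph _ sndE erefl) /=.
rewrite [X in X + _]big1 ?add0r => [|b _]; last exact: scaler0.
rewrite [RHS]matrix_sum_delta; apply: eq_bigr => b _.
by rewrite big_ord1 mxE.
Qed.

Lemma pair_coord_span (p : V) : p = \sum_i pair_coord i p *: pair_dir i.
Proof.
rewrite sum_pair_dir [LHS]surjective_pairing.
by congr (_, _); apply/colP => b; rewrite mxE.
Qed.

(** [class_C] only speaks of directional derivatives. [differentiable_C1] along the coordinate
    directions upgrades this to differentiability, first for a coordinate of [f], then for the same
    coordinate of ['D_w f]. *)
Lemma class_C2_diff2 (f : V -> 'cV[R]_d) (r : 'I_d) :
  class_C 2 f -> diff2 (fun p => f p r 0).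
Proof.
move=> [_ fC].
have coordE (h : V -> 'cV[R]_d) w : (forall x, derivable h x w) ->
    'D_w (fun p => h p r 0) = (fun p => 'D_w h p r 0).
  by move=> dh; apply/funext => x; rewrite derive_mx // mxE.
have coordd (h : V -> 'cV[R]_d) w x : derivable h x w ->
    derivable (fun p => h p r 0) x w.
  by move/derivable_mxP.
have coordc (h : V -> 'cV[R]_d) : continuous h ->
    continuous (fun p => h p r 0).
  move=> ch x; apply: (@continuous_comp _ _ _ h (fun z : 'cV[R]_d => z r 0)).
    exact: ch.
  exact: coord_continuous.
have spanned := differentiable_C1 pair_coord_continuous pair_coord_span.
split=> [x|w x].
  apply: spanned => [i y|i].
    by apply: coordd; case: (fC (pair_dir i)).
  have [df [dfc _]] := fC (pair_dir i).
  by rewrite coordE //; exact: coordc.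
have [df [_ dfC]] := fC w.
rewrite coordE //; apply: spanned => [i y|i].
  by apply: coordd; case: (dfC (pair_dir i)).
have [ddf ddfc] := dfC (pair_dir i).
by rewrite coordE //; exact: coordc.
Qed.
End coordinates.

(** * Entrywise calculus of vector-valued maps: linear layers, sums, activations, messages *)

Definition smooth_cV (R : realType) (U : normedModType R) (d : nat)
    (h : U -> 'cV[R]_d) : Prop :=
  forall r, diff2 (fun X => h X r 0).

Definition derive_cV (R : realType) (U : normedModType R) (d : nat) (F : U)
    (h : U -> 'cV[R]_d) (X : U) : 'cV[R]_d :=
  \col_r 'D_F (fun Y => h Y r 0) X.

Definition derive2_cV (R : realType) (U : normedModType R) (d : nat) (E F : U)
    (h : U -> 'cV[R]_d) (X : U) : 'cV[R]_d :=
  \col_r 'D_E ('D_F (fun Y => h Y r 0)) X.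

Section vector_functions.
Context {R : realType} {U : normedModType R} {d : nat}.
Implicit Types (E F X : U) (h z : U -> 'cV[R]_d) (M : 'M[R]_d).

Section mulmx.
Variables (M : 'M[R]_d) (h : U -> 'cV[R]_d).
Hypothesis hS : smooth_cV h.

Let mulmxE r : (fun X => (M *m h X) r 0) = (fun X => \sum_s M r s * h X s 0).
Proof. by apply/funext => X; rewrite mxE. Qed.

Lemma smooth_mulmx : smooth_cV (fun X => M *m h X).
Proof. by move=> r; rewrite mulmxE; apply: diff2_lincomb => s; exact: hS. Qed.

Lemma derive_mulmx F X :
  derive_cV F (fun X => M *m h X) X = M *m derive_cV F h X.
Proof.
apply/colP => r; rewrite mxE mulmxE derive_lincomb => [|s].
  by rewrite mxE; apply: eq_bigr => s _; rewrite mxE.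
by case: (hS s).
Qed.

Lemma derive2_mulmx E F X :
  derive2_cV E F (fun X => M *m h X) X = M *m derive2_cV E F h X.
Proof.
apply/colP => r; rewrite mxE mulmxE derive2_lincomb // mxE.
by apply: eq_bigr => s _; rewrite mxE.
Qed.
End mulmx.

Section sum.
Context {I : finType}.
Variables (a : I -> R) (h : I -> U -> 'cV[R]_d).
Hypothesis hS : forall i, smooth_cV (h i).

Let sumE r : (fun X => (\sum_i a i *: h i X) r 0) =
  (fun X => \sum_i a i * h i X r 0).
Proof.
by apply/funext => X; rewrite summxE; apply: eq_bigr => i _; rewrite mxE.
Qed.

Lemma smooth_sum : smooth_cV (fun X => \sum_i a i *: h i X).
Proof. by move=> r; rewrite sumE; apply: diff2_lincomb => s; exact: hS. Qed.

Lemma derive_sum_cV F X : derive_cV F (fun X => \sum_i a i *: h i X) X =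
  \sum_i a i *: derive_cV F (h i) X.
Proof.
apply/colP => r; rewrite mxE sumE derive_lincomb => [|s].
  by rewrite summxE; apply: eq_bigr => s _; rewrite !mxE.
by case: (hS s r).
Qed.

Lemma derive2_sum_cV E F X :
  derive2_cV E F (fun X => \sum_i a i *: h i X) X =
  \sum_i a i *: derive2_cV E F (h i) X.
Proof.
apply/colP => r; rewrite mxE sumE derive2_lincomb => [|s].
  by rewrite summxE; apply: eq_bigr => s _; rewrite !mxE.
exact: hS.
Qed.
End sum.

Section add.
Variables h z : U -> 'cV[R]_d.
Hypotheses (hS : smooth_cV h) (zS : smooth_cV z).

Let addE r : (fun X => (h X + z X) r 0) = (fun X => h X r 0 + z X r 0).
Proof. by apply/funext => X; rewrite mxE. Qed.

Lemma smoothD : smooth_cV (fun X => h X + z X).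
Proof. by move=> r; rewrite addE; exact: diff2D. Qed.

Lemma deriveD_cV F X : derive_cV F (fun X => h X + z X) X =
  derive_cV F h X + derive_cV F z X.
Proof.
apply/colP => r; rewrite !mxE addE deriveD //; apply: diff_derivable.
  by case: (hS r).
by case: (zS r).
Qed.

Lemma derive2D_cV E F X : derive2_cV E F (fun X => h X + z X) X =
  derive2_cV E F h X + derive2_cV E F z X.
Proof.
apply/colP => r; rewrite [LHS]mxE addE derive2D //.
by rewrite [RHS]mxE; congr (_ + _); rewrite mxE.
Qed.
End add.

Section activation.
Variables (sigma : R -> R) (z : U -> 'cV[R]_d).
Hypotheses (sS : diff2 sigma) (zS : smooth_cV z).

Let spanE r X :
  span_map (fun _ : 'I_1 => 1 : R) (fun _ X => z X r 0) X = z X r 0.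
Proof. by rewrite /span_map big_ord1 [_ *: _]mulr1. Qed.

(** The real line is spanned by the single direction 1, so an entrywise activation is a case of the
    general chain rule with a one-element index set. *)
Let mapE r : (fun X => map_mx sigma (z X) r 0) =
  sigma \o span_map (fun _ : 'I_1 => 1 : R) (fun _ X => z X r 0).
Proof. by apply/funext => X; rewrite mxE /= spanE. Qed.

Lemma smooth_map : smooth_cV (fun X => map_mx sigma (z X)).
Proof. by move=> r; rewrite mapE; apply: diff2_comp. Qed.

Variables (c : R).
Hypotheses (c1 : forall x, `|sigma^`()%classic x| <= c)
           (c2 : forall x, `|sigma^`(2)%classic x| <= c).

Let c_ge0 : 0 <= c.
Proof. exact: le_trans (c1 0). Qed.

Lemma enorm_derive_map F X :
  enorm (derive_cV F (fun X => map_mx sigma (z X)) X)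
  <= c * enorm (derive_cV F z X).
Proof.
apply: enorm_le => // r; rewrite !mxE mapE derive_comp_span; last 2 first.
- by move=> _ x; case: (zS r).
- by case: sS.
by rewrite big_ord1 spanE normrM ler_wpM2r // -derive1E.
Qed.

(** The second derivative splits into a [sigma''] term [s1], an entrywise product of first
    derivatives whose norm is at most the product of the norms, and a [sigma'] term [s2]. *)
Lemma enorm_derive2_map E F X :
  enorm (derive2_cV E F (fun X => map_mx sigma (z X)) X)
  <= c * (enorm (derive_cV E z X) * enorm (derive_cV F z X)
          + enorm (derive2_cV E F z X)).
Proof.
pose s1 := \col_(r < d) (sigma^`(2)%classic (z X r 0) *
  (derive_cV E z X r 0 * derive_cV F z X r 0)).
pose s2 := \col_(r < d) (sigma^`()%classic (z X r 0) * derive2_cV E F z X r 0).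
have sigma2E x : 'D_1 ('D_1 sigma) x = sigma^`(2)%classic x.
  have <- : sigma^`()%classic = 'D_1 sigma by apply/funext => y; rewrite derive1E.
  by rewrite -derive1E derive1nS derive1n1.
have -> : derive2_cV E F (fun X => map_mx sigma (z X)) X = s1 + s2.
  apply/colP => r; rewrite [LHS]mxE mapE derive2_comp //.
  rewrite !big_ord1 spanE sigma2E -derive1E -mulrA.
  by rewrite [RHS]mxE [s1 _ _]mxE [s2 _ _]mxE !mxE.
apply: le_trans (enormD _ _) _; rewrite mulrDr lerD //.
  apply: (@le_trans _ _ (c * enorm
      (\col_r (derive_cV E z X r 0 * derive_cV F z X r 0)))).
    by apply: enorm_le => // r; rewrite !mxE normrM ler_wpM2r.
  by rewrite ler_wpM2l // enorm_hadamard.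
by apply: enorm_le => // r; rewrite !mxE normrM ler_wpM2r.
Qed.
End activation.

Section message.
Variables (f : 'cV[R]_d * 'cV[R]_d -> 'cV[R]_d) (h1 h2 : U -> 'cV[R]_d).
Hypotheses (fC2 : class_C 2 f) (h1S : smooth_cV h1) (h2S : smooth_cV h2).

Let g (i : 'I_d + 'I_d) (X : U) : R :=
  match i with inl b => h1 X b 0 | inr b => h2 X b 0 end.

Let g_diff2 i : diff2 (g i).
Proof. by case: i. Qed.

Let spanE X : span_map pair_dir g X = (h1 X, h2 X).
Proof.
by rewrite /span_map sum_pair_dir; congr (_, _); apply/colP => b; rewrite mxE.
Qed.

Let pairE r : (fun X => f (h1 X, h2 X) r 0) =
  (fun p => f p r 0) \o span_map pair_dir g.
Proof. by apply/funext => X /=; rewrite spanE. Qed.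

Lemma smooth_message : smooth_cV (fun X => f (h1 X, h2 X)).
Proof.
move=> r; rewrite pairE; apply: diff2_comp => //; exact: class_C2_diff2.
Qed.

Let jacobianE X (x1 x2 : 'cV[R]_d) r :
  (partial_jacobian f (@dir1 R d) (h1 X, h2 X) *m x1
   + partial_jacobian f (@dir2 R d) (h1 X, h2 X) *m x2) r 0 =
  \sum_i 'D_(pair_dir i) (fun p => f p r 0) (h1 X, h2 X) *
    match i with inl b => x1 b 0 | inr b => x2 b 0 end.
Proof.
by rewrite big_sumType !mxE; congr (_ + _); apply: eq_bigr => b _; rewrite mxE.
Qed.

Lemma derive_message F X : derive_cV F (fun X => f (h1 X, h2 X)) X =
  partial_jacobian f (@dir1 R d) (h1 X, h2 X) *m derive_cV F h1 X
  + partial_jacobian f (@dir2 R d) (h1 X, h2 X) *m derive_cV F h2 X.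
Proof.
apply/colP => r; rewrite jacobianE mxE pairE derive_comp_span; last 2 first.
- by move=> i x; case: (g_diff2 i).
- by case: (class_C2_diff2 r fC2).
by rewrite spanE; apply: eq_bigr => -[b|b] _; rewrite mxE.
Qed.

(** Undoing the flattening by [curry_mxvec_bij] turns the matrix product into the double sum that
    the second-order chain rule produces. *)
Let hessian_blockE (ea eb : 'I_d -> 'cV[R]_d * 'cV[R]_d) p
    (x y : 'cV[R]_d) r :
  (hessian_block f ea eb p *m (mxvec (x *m y^T))^T) r 0 =
  \sum_b \sum_c 'D_(ea b) ('D_(eb c) (fun q => f q r 0)) p * (x b 0 * y c 0).
Proof.
rewrite mxE (reindex _ (curry_mxvec_bij d d)) pair_bigA /=.
apply: eq_bigr => -[b c] _ /=.
by rewrite mxE mxvecE mxE mxE mxvecE mxE big_ord1 mxE.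
Qed.

Let add4E (x1 x2 x3 x4 : 'cV[R]_d) r :
  (x1 + x2 + (x3 + x4)) r 0 = x1 r 0 + x2 r 0 + (x3 r 0 + x4 r 0).
Proof. by rewrite !mxE. Qed.

Lemma derive2_message E F X :
  let H ea eb x y := hessian_block f ea eb (h1 X, h2 X) *m (mxvec (x *m y^T))^T in
  derive2_cV E F (fun X => f (h1 X, h2 X)) X =
  (H (@dir1 R d) (@dir1 R d) (derive_cV E h1 X) (derive_cV F h1 X)
   + H (@dir1 R d) (@dir2 R d) (derive_cV E h1 X) (derive_cV F h2 X)
   + (H (@dir2 R d) (@dir1 R d) (derive_cV E h2 X) (derive_cV F h1 X)
   + H (@dir2 R d) (@dir2 R d) (derive_cV E h2 X) (derive_cV F h2 X)))
  + (partial_jacobian f (@dir1 R d) (h1 X, h2 X) *m derive2_cV E F h1 X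
     + partial_jacobian f (@dir2 R d) (h1 X, h2 X) *m derive2_cV E F h2 X).
Proof.
move=> H; apply/colP => r; rewrite [RHS]mxE jacobianE [LHS]mxE pairE.
rewrite derive2_comp //; last exact: class_C2_diff2.
rewrite spanE; congr (_ + _); last first.
  by apply: eq_bigr => -[b|b] _; rewrite [in RHS]mxE.
under eq_bigr do rewrite mulr_suml.
rewrite exchange_big /=.
rewrite big_sumType /=.
rewrite {}/H.
rewrite add4E.
congr (_ + _).
  rewrite [X in _ = X + _]hessian_blockE [X in _ = _ + X]hessian_blockE.
  rewrite -big_split /=; apply: eq_bigr => b _.
  rewrite big_sumType /=.
  congr (_ + _); apply: eq_bigr => c _;
    by rewrite -mulrA ![derive_cV _ _ _ _ _]mxE.
rewrite [X in _ = X + _]hessian_blockE [X in _ = _ + X]hessian_blockE.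
rewrite -big_split /=; apply: eq_bigr => b _; rewrite big_sumType /=.
congr (_ + _); apply: eq_bigr => c _;
  by rewrite -mulrA ![derive_cV _ _ _ _ _]mxE.
Qed.

Variables (c1 c2 cc2 : R).
Hypotheses
  (f1 : forall p, opnorm (partial_jacobian f (@dir1 R d) p) <= c1)
  (f2 : forall p, opnorm (partial_jacobian f (@dir2 R d) p) <= c2)
  (f3 : forall p, opnorm (hessian f p) <= cc2).

Lemma enorm_derive_message F X :
  enorm (derive_cV F (fun X => f (h1 X, h2 X)) X)
  <= c1 * enorm (derive_cV F h1 X) + c2 * enorm (derive_cV F h2 X).
Proof.
rewrite derive_message; apply: le_trans (enormD _ _) _.
by apply: lerD; exact: enorm_mulmx_le.
Qed.

(** Each of the four Hessian blocks is bounded by [cc2] separately; the four resulting products of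
    norms add up to the product of the two sums. *)
Lemma enorm_derive2_message E F X :
  enorm (derive2_cV E F (fun X => f (h1 X, h2 X)) X)
  <= cc2 * ((enorm (derive_cV E h1 X) + enorm (derive_cV E h2 X))
            * (enorm (derive_cV F h1 X) + enorm (derive_cV F h2 X)))
     + (c1 * enorm (derive2_cV E F h1 X) + c2 * enorm (derive2_cV E F h2 X)).
Proof.
rewrite derive2_message; apply: le_trans (enormD _ _) _; apply: lerD; last first.
  by apply: le_trans (enormD _ _) _; apply: lerD; exact: enorm_mulmx_le.
set a1 := derive_cV E h1 X; set a2 := derive_cV E h2 X.
set b1 := derive_cV F h1 X; set b2 := derive_cV F h2 X.
have HB (x y : 'cV[R]_d) := @enorm_block_mx R _ _ _ _
   (hessian_block f (@dir1 R d) (@dir1 R d) (h1 X, h2 X))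
   (hessian_block f (@dir1 R d) (@dir2 R d) (h1 X, h2 X))
   (hessian_block f (@dir2 R d) (@dir1 R d) (h1 X, h2 X))
   (hessian_block f (@dir2 R d) (@dir2 R d) (h1 X, h2 X))
   (mxvec (x *m y^T))^T (mxvec (x *m y^T))^T.
have cE (x y : 'cV[R]_d) : opnorm (hessian f (h1 X, h2 X)) * enorm (mxvec (x *m y^T))^T
    <= cc2 * (enorm x * enorm y).
  by rewrite enorm_outer ler_wpM2r // mulr_ge0 // enorm_ge0.
have -> : cc2 * ((enorm a1 + enorm a2) * (enorm b1 + enorm b2)) =
    cc2 * (enorm a1 * enorm b1) + cc2 * (enorm a1 * enorm b2)
    + (cc2 * (enorm a2 * enorm b1) + cc2 * (enorm a2 * enorm b2)).
  by move: (enorm a1) (enorm a2) (enorm b1) (enorm b2) => p1 p2 q1 q2; ring.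
apply: le_trans (enormD _ _) _; apply: lerD.
  apply: le_trans (enormD _ _) _; apply: lerD.
    by have [B _ _ _] := HB a1 b1; exact: le_trans B (cE a1 b1).
  by have [_ B _ _] := HB a1 b2; exact: le_trans B (cE a1 b2).
apply: le_trans (enormD _ _) _; apply: lerD.
  by have [_ _ B _] := HB a2 b1; exact: le_trans B (cE a2 b1).
by have [_ _ _ B] := HB a2 b2; exact: le_trans B (cE a2 b2).
Qed.
End message.
End vector_functions.

(** * Derivatives of the readout *)

Lemma derive_selection (R : realType) (U : normedModType R) (I : finType)
    (f : U -> R) (H : I -> U -> R) (x v : U) :
  derivable f x v -> (forall i, derivable (H i) x v) ->
  (\forall s \near (0 : R), exists i, f (x + s *: v) = H i (x + s *: v)) ->
  exists i, 'D_v f x = 'D_v (H i) x.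
Proof.
move=> df dH sel; apply: contrapT => /forallNP ne.
have away i : \forall s \near (0 : R)^', f (x + s *: v) != H i (x + s *: v).
  have [g [gE dg Dg]] : exists g : U -> R, [/\ forall y, g y = f y - H i y,
      derivable g x v & 'D_v g x = 'D_v f x - 'D_v (H i) x].
    exists (f - H i); split=> [y||]; first by [].
      exact: derivableB df (dH i).
    exact: deriveB df (dH i).
  have Dg0 : 'D_v g x != 0 by rewrite Dg subr_eq0; apply/eqP/ne.
  suff : \forall s \near (0 : R)^', g (s *: v + x) != 0.
    apply: filterS => s; apply: contra_neq => E.
    by rewrite [s *: v + x]addrC gE E subrr.
  (* If [g] vanishes at [x], its difference quotient is [g (s *: v + x) / s] and tends to a nonzero
     limit; otherwise continuity along the line keeps [g] away from 0. *)
  have [gx0|gx0] := eqVneq (g x) 0.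
    have /cvgr_neq0 /(_ Dg0) := dg; apply: filterS => s /=.
    by apply: contra_neq => ->; rewrite gx0 subrr scaler0.
  have : {for 0, continuous (fun s : R => g (s *: v + x))}.
    apply: differentiable_continuous; apply/derivable1_diffP.
    exact: (derivable1P g x v).1.
  rewrite /prop_for /continuous_at scale0r add0r => gc.
  by have /cvgr_neq0 /(_ gx0) := gc; exact: nbhs_dnbhs.
(* Finiteness of [I] makes the punctured neighborhood common to all indices. *)
have allaway : \forall s \near (0 : R)^',
    forall i, f (x + s *: v) != H i (x + s *: v).
  by apply: (@filter_forall _ I _ (0 : R)^'); exact: away.
near ((0 : R)^') => s.
have [i /eqP] : exists i, f (x + s *: v) = H i (x + s *: v).
  by near: s; exact: nbhs_dnbhs.
apply/negP; move: i; near: s; exact: allaway.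
Unshelve. all: by end_near. Qed.

Section readout.
Context {R : realType} {n d : nat}.

(* Every readout is, pointwise, one of finitely many linear combinations of the
   node features: [w] records, for each coordinate, a node where the maximum is
   attained. *)
Definition read_weight (rd : readout) (w : {ffun 'I_d -> 'I_n}) (r : 'I_d)
    (v : 'I_n) : R :=
  match rd with
  | MAX => (w r == v)%:R
  | MEAN => n%:R^-1
  | SUM => 1
  end.

Lemma read_weight_ge0_le1 rd w r v : 0 < n%:R :> R ->
  0 <= read_weight rd w r v <= 1.
Proof.
move=> n0; case: rd => /=; first by case: eqP; rewrite ?lexx ?ler01.
  by rewrite invr_ge0 ltW //= invf_le1 // ler1n -(ltr_nat R).
by rewrite ler01 lexx.
Qed.

(** For [MAX], the supremum over the finite nonempty range is attained, and [w r] is a node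
    attaining it; [v0] provides nonemptiness. *)
Lemma readE rd (h : 'I_n -> 'cV[R]_d) (v0 : 'I_n) :
  exists w, forall r, read rd h r 0 = \sum_v read_weight rd w r v * h v r 0.
Proof.
exists [ffun r => [arg max_(v > v0) h v r 0]%O] => r.
rewrite mxE; case: rd => /=; last 2 first.
- by rewrite mulr_sumr.
- by apply: eq_bigr => v _; rewrite mul1r.
rewrite ffunE; case: arg_maxP => // v _ vmax.
rewrite (bigD1 v) //= eqxx mul1r big1 ?addr0 => [|u /negbTE]; last first.
  by rewrite eq_sym => ->; rewrite mul0r.
apply/le_anti/andP; split.
  by apply: ge_sup => [|_ [u _ <-]]; [exists (h v r 0), v|exact: vmax].
apply: ub_le_sup; last by exists v.
by exists (h v r 0) => _ [u _ <-]; exact: vmax.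
Qed.

Section mixed_derivative.
Context {U : normedModType R}.
Variables (h : 'I_n -> U -> 'cV[R]_d) (rd : readout) (theta : 'cV[R]_d).
Hypothesis h_smooth : forall v, smooth_cV (h v).

(** The output with the selected nodes frozen to [w]: unlike [y], it is twice differentiable for
    every readout. *)
Let piece (w : {ffun 'I_d -> 'I_n}) (X : U) : R :=
  \sum_v \sum_r (theta r 0 * read_weight rd w r v) * h v X r 0.

Let pieceE w : piece w = (fun X => \sum_(p : 'I_n * 'I_d)
  (theta p.2 0 * read_weight rd w p.2 p.1) * h p.1 X p.2 0).
Proof. by apply/funext => X; rewrite /piece pair_bigA. Qed.

Let piece_diff2 w : diff2 (piece w).
Proof. by rewrite pieceE; apply: diff2_lincomb => p; exact: h_smooth. Qed.

Let y X := (theta^T *m read rd (fun v => h v X)) 0 0.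

Let y_piece (v0 : 'I_n) X : exists w, y X = piece w X.
Proof.
have [w wE] := readE rd (fun v => h v X) v0.
exists w; rewrite /y mxE /piece exchange_big /=; apply: eq_bigr => r _.
rewrite mxE wE mulr_sumr; apply: eq_bigr => v _.
by rewrite mulrA.
Qed.

Lemma derive2_read_le (v0 : 'I_n) E F X : enorm theta = 1 ->
  (\forall s \near (0 : R), derivable y (X + s *: E) F) ->
  derivable ('D_F y) X E ->
  `|'D_E ('D_F y) X| <= \sum_v enorm (derive2_cV E F (h v) X).
Proof.
move=> theta1 dy ddy.
have dpiece w Z : derivable (piece w) Z F.
  by apply: diff_derivable; case: (piece_diff2 w).
(* The inner use of [derive_selection], at each nearby point [X + s *: E], shows that ['D_F y] is
   there the first derivative of some piece; the outer use then selects a piece for the derivative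
   along [E]. *)
have [w ->] : exists w, 'D_E ('D_F y) X = 'D_E ('D_F (piece w)) X.
  apply: (derive_selection (H := fun w => 'D_F (piece w)) ddy) => [w|].
    by apply: diff_derivable; case: (piece_diff2 w).
  apply: filterS dy => s dys.
  apply: (derive_selection dys (fun w => dpiece w _)).
  by near=> t; exact: y_piece v0 _.
have n0 : 0 < n%:R :> R by rewrite ltr0n (leq_trans _ (ltn_ord v0)).
rewrite pieceE derive2_lincomb => [|p]; last exact: h_smooth.
rewrite -(pair_bigA _ (fun v r => (theta r 0 * read_weight rd w r v) *
  'D_E ('D_F (fun Z => h v Z r 0)) X)) /=.
apply: le_trans (ler_norm_sum _ _ _) _; apply: ler_sum => v _.
(* Readout weights lie in [0, 1], so they do not increase the norm of the second derivative at a
   node; Cauchy-Schwarz with the unit vector [theta] then removes [theta]. *)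
pose z := \col_r (read_weight rd w r v * derive2_cV E F (h v) X r 0).
have zE : enorm z <= enorm (derive2_cV E F (h v) X).
  rewrite -[leRHS]mul1r; apply: enorm_le => // r; rewrite mxE normrM mul1r.
  have /andP[k0 k1] := read_weight_ge0_le1 rd w r v n0.
  by rewrite ler_piMl // ger0_norm.
apply: le_trans zE; rewrite -[leRHS]mul1r -theta1.
have -> : \sum_r theta r 0 * read_weight rd w r v *
    'D_E ('D_F (fun Z => h v Z r 0)) X = \sum_r theta r 0 * z r 0.
  by apply: eq_bigr => r _; rewrite [z r 0]mxE [derive2_cV _ _ _ _ _ _]mxE mulrA.
rewrite ler_norml enorm_dot andbT lerNl.
have := enorm_dot theta (- z).
rewrite -[in enorm (- z)]scaleN1r enormZ normrN1 mul1r; apply: le_trans.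
by rewrite -sumrN; apply: ler_sum => r _; rewrite [(- z) r 0]mxE mulrN.
Unshelve. all: by end_near. Qed.
End mixed_derivative.
End readout.

(** * Bounds along the layers *)

Lemma derive_entry (R : realType) (n d : nat) (v : 'I_n) (r : 'I_d)
    (F X : 'M[R]_(n, d)) :
  'D_F (fun Y : 'M[R]_(n, d) => Y v r) X = F v r.
Proof.
have <- : 'D_F id X v r = F v r by rewrite derive_id.
by rewrite derive_mx ?mxE.
Qed.

Lemma derive_entryE (R : realType) (n d : nat) (v : 'I_n) (r : 'I_d)
    (F : 'M[R]_(n, d)) :
  'D_F (fun Y : 'M[R]_(n, d) => Y v r) = cst (F v r).
Proof. by apply/funext => X; exact: derive_entry. Qed.

Lemma diff2_entry (R : realType) (n d : nat) (v : 'I_n) (r : 'I_d) :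
  diff2 (fun X : 'M[R]_(n, d) => X v r).
Proof.
split=> [X|F X]; first exact: differentiable_coord.
by rewrite derive_entryE; exact: differentiable_cst.
Qed.

Lemma trmx_diag_mulmx (R : realType) (n : nat) (M N : 'M[R]_n) (s : 'rV[R]_n)
    (i j : 'I_n) :
  (M^T *m diag_mx s *m N) i j = \sum_l M l i * s 0 l * N l j.
Proof. by rewrite mxE; apply: eq_bigr => l _; rewrite mul_mx_diag !mxE. Qed.

Section mpnn.
Context {R : realType} {n d m : nat}.
Variables (A : 'M[R]_n) (sigma : R -> R) (Om W : nat -> 'M[R]_d)
  (psi : nat -> 'cV[R]_d * 'cV[R]_d -> 'cV[R]_d) (c_sigma om w c1 c2 cc2 : R).
Hypotheses
  (A_ge0 : forall i j, 0 <= A i j)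
  (sigma_C2 : class_C 2 sigma)
  (psi_C2 : forall t : nat, (1 <= t <= m)%N -> class_C 2 (psi t))
  (w_gt0 : 0 < w)
  (sigma_d1 : forall x : R, `| sigma^`()%classic x | <= c_sigma)
  (sigma_d2 : forall x : R, `| sigma^`(2)%classic x | <= c_sigma)
  (Om_le : forall t : nat, (1 <= t <= m)%N -> opnorm (Om t) <= om)
  (W_le : forall t : nat, (1 <= t <= m)%N -> opnorm (W t) <= w)
  (psi_d1 : forall t : nat, (1 <= t <= m)%N ->
    forall p, opnorm (partial_jacobian (psi t) (@dir1 R d) p) <= c1)
  (psi_d2 : forall t : nat, (1 <= t <= m)%N ->
    forall p, opnorm (partial_jacobian (psi t) (@dir2 R d) p) <= c2)
  (psi_hess : forall t : nat, (1 <= t <= m)%N ->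
    forall p, opnorm (hessian (psi t) p) <= cc2).

Let h t i (X : 'M[R]_(n, d)) := mpnn_layer A sigma Om W psi X t i.
Let msg t i j (X : 'M[R]_(n, d)) := psi t.+1 (h t i X, h t j X).
Let z t i (X : 'M[R]_(n, d)) :=
  Om t.+1 *m h t i X + W t.+1 *m \sum_(j < n) A i j *: msg t i j X.
Let S := S_mx A om w c1 c2.
Let rho := c_sigma * w.

Let sigma_diff2 : diff2 sigma.
Proof. exact: class_C2_diff2_real. Qed.

Let c_sigma_ge0 : 0 <= c_sigma.
Proof. exact: le_trans (sigma_d1 0). Qed.

Section preactivation.
Variable t : nat.
Hypotheses (tm : (t < m)%N) (hS : forall i, smooth_cV (h t i)).

Let tm1 : (1 <= t.+1 <= m)%N.
Proof. exact: tm. Qed.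

Let smooth_msg i j : smooth_cV (msg t i j).
Proof. by apply: smooth_message => //; exact: psi_C2. Qed.

Let smooth_z1 i : smooth_cV (fun X => Om t.+1 *m h t i X).
Proof. exact: smooth_mulmx. Qed.

Let smooth_agg i : smooth_cV (fun X => \sum_(j < n) A i j *: msg t i j X).
Proof. exact: smooth_sum. Qed.

Let smooth_z2 i :
  smooth_cV (fun X => W t.+1 *m \sum_(j < n) A i j *: msg t i j X).
Proof. exact: smooth_mulmx. Qed.

Lemma smooth_preactivation i : smooth_cV (z t i).
Proof. exact: smoothD. Qed.

Let enorm_update i (x : 'cV[R]_d) (y : 'I_n -> 'cV[R]_d) bx (b : 'I_n -> R) :
  enorm x <= bx -> (forall j, enorm (y j) <= b j) ->
  enorm (Om t.+1 *m x + W t.+1 *m \sum_(j < n) A i j *: y j)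
  <= om * bx + w * \sum_(j < n) A i j * b j.
Proof.
move=> xb yb; apply: le_trans (enormD _ _) _; apply: lerD.
  by apply: enorm_mulmx_le => //; exact: Om_le.
apply: enorm_mulmx_le; first exact: W_le.
apply: le_trans (enorm_sum _) _; apply: ler_sum => j _.
by rewrite enormZ ger0_norm // ler_wpM2l.
Qed.

(** This identity explains the shape of [S]: one layer sends bounds [b] on the features to [w] times
    [S] applied to [b], the entry [om / w] accounting for the residual matrix [Om]. The
    inhomogeneous part [q] is 0 for first derivatives and the Hessian term for second ones. *)
Let S_update i (b : 'I_n -> R) (q : 'I_n -> R) :
  om * b i + w * \sum_(j < n) A i j * (q j + (c1 * b i + c2 * b j)) =
  w * (\sum_j S i j * b j + \sum_j A i j * q j).
Proof.
have -> : \sum_j S i j * b j =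
    om / w * b i + c1 * (\sum_j A i j) * b i + c2 * \sum_j A i j * b j.
  have Sij j : S i j * b j = (om / w *+ (i == j)) * b j
      + c1 * ((\sum_l A i l) *+ (i == j)) * b j + c2 * (A i j * b j).
    rewrite /S /S_mx /diag_deg !mxE.
    rewrite (eq_bigr (fun l => A i l)); last by move=> l _; rewrite mxE mulr1.
    by rewrite !mulrDl mulrA.
  move: (\sum_l A i l) Sij => deg Sij.
  rewrite (eq_bigr _ (fun j _ => Sij j)) !big_split /= -mulr_sumr.
  congr (_ + _ + _); rewrite (bigD1 i) //= eqxx !mulr1n big1 ?addr0 // => j ji.
    by rewrite eq_sym (negbTE ji) mulr0n mul0r.
  by rewrite eq_sym (negbTE ji) mulr0n mulr0 mul0r.
rewrite (eq_bigr (fun j => A i j * q j + (c1 * b i * A i j + c2 * (A i j * b j)))).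
  rewrite !big_split /= -!mulr_sumr.
  set s1 := \sum_j _; set s2 := \sum_j A i j; set s3 := \sum_j _.
  by field; rewrite gt_eqF.
by move=> j _; ring.
Qed.

Let c1_ge0 : 0 <= c1.
Proof. exact: le_trans (opnorm_ge0 _) (psi_d1 tm1 (0, 0)). Qed.

Let c2_ge0 : 0 <= c2.
Proof. exact: le_trans (opnorm_ge0 _) (psi_d2 tm1 (0, 0)). Qed.

Let cc2_ge0 : 0 <= cc2.
Proof. exact: le_trans (opnorm_ge0 _) (psi_hess tm1 (0, 0)). Qed.

Lemma enorm_derive_preactivation F X (b : 'I_n -> R) i :
  (forall j, enorm (derive_cV F (h t j) X) <= b j) ->
  enorm (derive_cV F (z t i) X) <= w * \sum_j S i j * b j.
Proof.
move=> hb; rewrite deriveD_cV // derive_mulmx // derive_mulmx //.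
rewrite derive_sum_cV //.
have -> : w * \sum_j S i j * b j =
    om * b i + w * \sum_(j < n) A i j * (0 + (c1 * b i + c2 * b j)).
  by rewrite S_update [X in _ + X]big1 ?addr0 // => j _; rewrite mulr0.
apply: enorm_update => // j; rewrite add0r.
apply: le_trans (enorm_derive_message _ _ _ (psi_d1 tm1) (psi_d2 tm1) _ _) _ => //.
  exact: psi_C2.
by apply: lerD; exact: ler_wpM2l.
Qed.

Lemma enorm_derive2_preactivation E F X (a b M : 'I_n -> R) i :
  (forall j, enorm (derive_cV E (h t j) X) <= a j) ->
  (forall j, enorm (derive_cV F (h t j) X) <= b j) ->
  (forall j, enorm (derive2_cV E F (h t j) X) <= M j) ->
  enorm (derive2_cV E F (z t i) X) <= w * (\sum_j S i j * M j +
    \sum_j A i j * (cc2 * ((a i + a j) * (b i + b j)))).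
Proof.
move=> ha hb hM; rewrite derive2D_cV // derive2_mulmx // derive2_mulmx //.
rewrite derive2_sum_cV // -S_update.
apply: enorm_update => // j.
apply: le_trans (enorm_derive2_message _ _ _ (psi_d1 tm1) (psi_d2 tm1)
  (psi_hess tm1) _ _ _) _ => //.
  exact: psi_C2.
apply: lerD; last by apply: lerD; exact: ler_wpM2l.
by rewrite ler_wpM2l // ler_pM ?addr_ge0 ?enorm_ge0 // lerD.
Qed.
End preactivation.

Let layer0E i r :
  (fun X => h 0 i X r 0) = (fun X : 'M[R]_(n, d) => X i r).
Proof. by apply/funext => X; rewrite /h /= !mxE. Qed.

Lemma smooth_layer t : (t <= m)%N -> forall i, smooth_cV (h t i).
Proof.
elim: t => [_|t IH tm] i.
  by move=> r; rewrite layer0E; exact: diff2_entry.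
apply: (smooth_map sigma_diff2); apply: smooth_preactivation => //.
exact: IH (ltnW tm).
Qed.

Lemma expr_mxS k i j : (S ^+ k.+1) i j = \sum_l S i l * (S ^+ k) l j.
Proof. by rewrite exprS -[S * _]/(S *m _) mxE. Qed.

Lemma enorm_derive_layer t v a X i : (t <= m)%N ->
  enorm (derive_cV (delta_mx v a) (h t i) X) <= rho ^+ t * (S ^+ t) i v.
Proof.
elim: t i => [|t IH] i tm.
  rewrite !expr0 mul1r.
  (* At depth 0 the feature of node [i] depends on [x_v] only if [i] is [v], which is the entry of
     the identity matrix [S ^+ 0]. *)
  have -> : derive_cV (delta_mx v a) (h 0 i) X =
      (i == v)%:R *: delta_mx a 0.
    apply/colP => r; rewrite [LHS]mxE layer0E derive_entry /= !mxE.
    by rewrite -natrM mulnb andbT.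
  by rewrite enormZ enorm_delta mulr1 normr_nat mxE.
have smz := smooth_preactivation tm (smooth_layer (ltnW tm)).
apply: le_trans (enorm_derive_map sigma_diff2 (smz i) sigma_d1 _ _) _.
rewrite expr_mxS exprS mulrAC.
rewrite [leRHS](_ : _ = c_sigma * (w * \sum_j S i j * (rho ^+ t * (S ^+ t) j v))).
  rewrite ler_wpM2l //; apply: enorm_derive_preactivation => //.
    exact: smooth_layer (ltnW tm).
  by move=> j; apply: IH (ltnW tm).
rewrite /rho -!mulrA; congr (_ * (_ * _)).
rewrite mulrC mulr_sumr; apply: eq_bigr => j _; ring.
Qed.

(** * Recurrence for the mixed derivatives and its closed form *)

Variables (v u : 'I_n).

(* [source t i] collects what the [t]-th layer adds to the mixed derivative at
   node [i], up to a power of [rho]; [mixing t] accumulates these terms along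
   the layers. *)
Let source t i : R :=
  w * (S ^+ t) i v * (S ^+ t) i u
  + cc2 * \sum_j A i j * (((S ^+ t.-1) i v + (S ^+ t.-1) j v)
                        * ((S ^+ t.-1) i u + (S ^+ t.-1) j u)).

Let mixing t i : R := \sum_(k < t)
  rho ^+ (2 * t - k - 1) * \sum_l (S ^+ k) i l * source (t - k) l.

(** The term [k = 0] is the contribution of the new layer. The terms [k.+1] are those of [mixing t]
    multiplied by [rho] and by one more factor [S]. *)
Let mixingS t i : mixing t.+1 i =
  rho * (\sum_j S i j * mixing t j) + rho ^+ (2 * t).+1 * source t.+1 i.
Proof.
rewrite /mixing big_ord_recl /= addrC; congr (_ + _).
  rewrite mulr_sumr.
  rewrite (eq_bigr (fun j => \sum_(k < t) rho * (S i j * (rho ^+ (2 * t - k - 1)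
     * \sum_l (S ^+ k) j l * source (t - k) l)))); last first.
    by move=> j _; rewrite !mulr_sumr.
  rewrite exchange_big /=; apply: eq_bigr => k _.
  rewrite /bump /= add1n subSS.
  have -> : (2 * t.+1 - k.+1 - 1 = (2 * t - k - 1).+1)%N.
    by have := ltn_ord k; lia.
  rewrite exprS -mulrA -mulr_sumr; congr (_ * _).
  rewrite (eq_bigr (fun l => \sum_j S i j * (S ^+ k) j l * source (t - k) l));
    last by move=> l _; rewrite expr_mxS mulr_suml.
  rewrite exchange_big /= mulr_sumr; apply: eq_bigr => j _.
  rewrite mulrCA !mulr_sumr; apply: eq_bigr => l _.
  by rewrite !mulrA.
rewrite subn0 subn1; congr (_ ^+ _ * _); first by lia.
rewrite (bigD1 i) //= expr0 mxE eqxx mul1r big1 ?addr0 // => j /negbTE ji.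
by rewrite mxE eq_sym ji mul0r.
Qed.

Lemma enorm_derive2_layer t a b X i : (t <= m)%N ->
  enorm (derive2_cV (delta_mx v a) (delta_mx u b) (h t i) X) <= mixing t i.
Proof.
elim: t i => [|t IH] i tm.
  rewrite /mixing big_ord0.
  have -> : derive2_cV (delta_mx v a) (delta_mx u b) (h 0 i) X = 0.
    by apply/colP => r; rewrite [LHS]mxE layer0E derive_entryE derive_cst mxE.
  by rewrite enorm0.
have smh := smooth_layer (ltnW tm).
have smz := smooth_preactivation tm smh.
apply: le_trans (enorm_derive2_map sigma_diff2 (smz i) sigma_d1 sigma_d2 _ _ _) _.
have dz q c := enorm_derive_preactivation tm smh i
  (fun j => enorm_derive_layer q c X j (ltnW tm)).
have ddz := enorm_derive2_preactivation tm smh i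
  (fun j => enorm_derive_layer v a X j (ltnW tm))
  (fun j => enorm_derive_layer u b X j (ltnW tm))
  (fun j => IH j (ltnW tm)).
have dzdz := ler_pM (enorm_ge0 _) (enorm_ge0 _) (dz v a) (dz u b).
apply: le_trans (ler_wpM2l c_sigma_ge0 (lerD dzdz ddz)) _.
(* The accumulated bound is exactly [mixing t.+1]. In the [sigma''] term, [c_sigma * w ^+ 2] is
   [rho * w], which is where the factor [w] in [source] comes from. *)
rewrite le_eqVlt; apply/orP; left; apply/eqP.
have pull q : \sum_j S i j * (rho ^+ t * (S ^+ t) j q) = rho ^+ t * (S ^+ t.+1) i q.
  by rewrite expr_mxS mulr_sumr; apply: eq_bigr => j _; rewrite mulrCA.
rewrite !pull mixingS /source /=.
have -> : \sum_j A i j * (cc2 *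
      ((rho ^+ t * (S ^+ t) i v + rho ^+ t * (S ^+ t) j v)
       * (rho ^+ t * (S ^+ t) i u + rho ^+ t * (S ^+ t) j u))) =
    cc2 * rho ^+ t * rho ^+ t * \sum_j A i j * (((S ^+ t) i v + (S ^+ t) j v)
      * ((S ^+ t) i u + (S ^+ t) j u)).
  by rewrite mulr_sumr; apply: eq_bigr => j _; ring.
rewrite [rho ^+ (2 * t).+1]exprS mul2n -addnn [rho ^+ (t + t)]exprD.
have rhoE : rho = c_sigma * w by [].
move: (\sum_j S i j * _) (\sum_j A i j * _) (rho ^+ t) => s1 s2 r.
by rewrite rhoE; ring.
Qed.

(** Expanding the product of the two sums inside [source] gives four terms: the two cross terms are
    [P_mx] and its transpose, the two others form the last summand of [Q_mx], with [diag_deg A] and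
    [A] respectively. *)
Let sum_source k : (k < m)%N ->
  \sum_l (\sum_i (S ^+ k) i l) * source (m - k) l =
  (w *: ((S ^+ (m - k))^T *m diag_mx ((ones R n)^T *m S ^+ k) *m S ^+ (m - k))
   + cc2 *: Q_mx A S m k) v u.
Proof.
move=> km; rewrite /source -subn1.
set p := S ^+ (m - k - 1).
pose s l := \sum_i (S ^+ k) i l.
have sE l : ((ones R n)^T *m S ^+ k) 0 l = s l.
  by rewrite mxE; apply: eq_bigr => i _; rewrite !mxE mul1r.
have degE l : (diag_deg A) l l = \sum_j A l j.
  rewrite /diag_deg !mxE eqxx mulr1n.
  by apply: eq_bigr => j _; rewrite mxE mulr1.
have tE l : ((ones R n)^T *m S ^+ k *m (diag_deg A + A)) 0 l =
    s l * (\sum_j A l j) + \sum_j s j * A j l.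
  rewrite mulmxDr mxE; congr (_ + _); last first.
    by rewrite mxE; apply: eq_bigr => j _; rewrite sE.
  by rewrite /diag_deg mul_mx_diag mxE sE -degE /diag_deg !mxE eqxx mulr1n.
have QE : Q_mx A S m k v u =
    \sum_l (p l v * s l * \sum_j A l j * p j u + p l u * s l * \sum_j A l j * p j v
      + p l v * (s l * (\sum_j A l j) + \sum_j s j * A j l) * p l u).
  rewrite /Q_mx mxE trmx_diag_mulmx [(P_mx _ _ _ _ + _) v u]mxE.
  rewrite [(P_mx _ _ _ _)^T v u]mxE /P_mx !trmx_diag_mulmx -!big_split /=.
  apply: eq_bigr => l _; rewrite !sE tE [(A *m _) l u]mxE [(A *m _) l v]mxE.
  by [].
rewrite [RHS]mxE [X in _ = _ + X]mxE QE [X in _ = X + _]mxE trmx_diag_mulmx.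
have AE l : \sum_j A l j * ((p l v + p j v) * (p l u + p j u)) =
    p l v * p l u * (\sum_j A l j) + p l v * (\sum_j A l j * p j u)
    + p l u * (\sum_j A l j * p j v) + \sum_j A l j * (p j v * p j u).
  rewrite !mulr_sumr -!big_split /=; apply: eq_bigr => j _; ring.
(* Exchanging the roles of [l] and [j] moves [A] onto the row vector [s], as in the diagonal matrix
   of [Q_mx]. *)
have exch : \sum_l s l * (\sum_j A l j * (p j v * p j u)) =
    \sum_l p l v * (\sum_j s j * A j l) * p l u.
  rewrite (eq_bigr (fun l => \sum_j s l * (A l j * (p j v * p j u)))); last first.
    by move=> l _; rewrite mulr_sumr.
  rewrite exchange_big; apply: eq_bigr => l _.
  by rewrite mulr_sumr mulr_suml; apply: eq_bigr => j _; ring.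
pose q l := p l v * s l * (\sum_j A l j * p j u)
  + p l u * s l * (\sum_j A l j * p j v)
  + p l v * (s l * (\sum_j A l j)) * p l u.
have -> : \sum_l (p l v * s l * (\sum_j A l j * p j u)
      + p l u * s l * (\sum_j A l j * p j v)
      + p l v * (s l * (\sum_j A l j) + \sum_j s j * A j l) * p l u) =
    \sum_l q l + \sum_l s l * (\sum_j A l j * (p j v * p j u)).
  rewrite exch -big_split /=; apply: eq_bigr => l _.
  by rewrite /q mulrDr mulrDl addrA.
rewrite -big_split /= !mulr_sumr -big_split /=; apply: eq_bigr => l _.
rewrite sE AE /q -/(s l).
move: (s l) (\sum_j A l j) (\sum_j A l j * p j u) (\sum_j A l j * p j v)
  (\sum_j A l j * (p j v * p j u)) => s0 s1 s2 s3 s4.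
by ring.
Qed.

Lemma sum_enorm_derive2_layer a b X :
  \sum_i enorm (derive2_cV (delta_mx v a) (delta_mx u b) (h m i) X)
  <= (\sum_(k < m) rho ^+ (2 * m - k - 1) *:
        (w *: ((S ^+ (m - k))^T *m diag_mx ((ones R n)^T *m S ^+ k)
                 *m S ^+ (m - k))
         + cc2 *: Q_mx A S m k)) v u.
Proof.
apply: (@le_trans _ _ (\sum_i mixing m i)).
  by apply: ler_sum => i _; exact: enorm_derive2_layer.
rewrite le_eqVlt; apply/orP; left; apply/eqP.
(* Summing over the nodes [i] turns [S ^+ k] into its column sums, the row vector on the diagonals
   of the bound. *)
rewrite summxE exchange_big /=; apply: eq_bigr => k _.
rewrite [RHS]mxE -sum_source // -mulr_sumr; congr (_ * _).
rewrite exchange_big /=; apply: eq_bigr => l _.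
by rewrite mulr_suml.
Qed.
End mpnn.

Theorem theorem3p2 (R : realType) (n d m : nat)
  (e : rel 'I_n)
  (e_sym : symmetric e)
  (e_conn : graph_connected e)
  (e_nbip : ~ graph_bipartite e)
  (A : 'M[R]_n)
  (A_edge : forall v u : 'I_n, e v u -> 0 < A v u)
  (A_nonedge : forall v u : 'I_n, ~~ e v u -> A v u = 0)
  (sigma : R -> R)
  (Om W : nat -> 'M[R]_d)
  (psi : nat -> 'cV[R]_d * 'cV[R]_d -> 'cV[R]_d)
  (rd : readout) (theta : 'cV[R]_d)
  (sigma_C2 : class_C 2 sigma)
  (psi_C2 : forall t : nat, (1 <= t <= m)%N -> class_C 2 (psi t))
  (c_sigma om w c1 c2 cc2 : R)
  (w_gt0 : 0 < w)
  (sigma_d1 : forall x : R, `| sigma^`()%classic x | <= c_sigma)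
  (sigma_d2 : forall x : R, `| sigma^`(2)%classic x | <= c_sigma)
  (Om_le : forall t : nat, (1 <= t <= m)%N -> opnorm (Om t) <= om)
  (W_le : forall t : nat, (1 <= t <= m)%N -> opnorm (W t) <= w)
  (psi_d1 : forall t : nat, (1 <= t <= m)%N ->
    forall p, opnorm (partial_jacobian (psi t) (@dir1 R d) p) <= c1)
  (psi_d2 : forall t : nat, (1 <= t <= m)%N ->
    forall p, opnorm (partial_jacobian (psi t) (@dir2 R d) p) <= c2)
  (psi_hess : forall t : nat, (1 <= t <= m)%N ->
    forall p, opnorm (hessian (psi t) p) <= cc2)
  (theta_unit : enorm theta = 1)
  (v u : 'I_n) :
  let S := S_mx A om w c1 c2 in
  (mix (mpnn_output A sigma Om W psi rd theta m) v u
   <= ((\sum_(k < m) (c_sigma * w) ^+ (2 * m - k - 1) *: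
          (w *: ((S ^+ (m - k))^T *m diag_mx ((ones R n)^T *m S ^+ k)
                   *m S ^+ (m - k))
           + cc2 *: Q_mx A S m k)) v u)%:E)%E.

Proof.
cbv zeta; have A_ge0 i j : 0 <= A i j.
  by have [/A_edge/ltW|/A_nonedge ->] := boolP (e i j).
(* The supremum is bounded element by element; [dy] and [ddy], the existence of the second
   derivative, are what the selection argument for the readout consumes. *)
apply: ge_ereal_sup => _ [X [a [b [[dy ddy] ->]]]]; rewrite lee_fin.
apply: le_trans (sum_enorm_derive2_layer A_ge0 sigma_C2 psi_C2 w_gt0 sigma_d1
  sigma_d2 Om_le W_le psi_d1 psi_d2 psi_hess v u a b X).
apply: derive2_read_le => //.
by move=> i; apply: (smooth_layer A Om W sigma_C2 psi_C2 (leqnn m) i).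
Qed.
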